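(* Let $N\ge1$ and let $\mathcal{A},\mathcal{B}\in\mathbb{R}^{d\times d}$, $d=\frac12(N+1)(N+2)$, be the coefficient matrices of the two-dimensional real-valued $P_N$ system $\partial_t\boldsymbol{u}+\mathcal{A}\,\partial_x\boldsymbol{u}+\mathcal{B}\,\partial_y\boldsymbol{u}=\mathcal{Q}\boldsymbol{u}$, that is, $$(\mathcal{A})_{\alpha\beta}=\langle\Omega_x\Phi_\beta,\Phi_\alpha\rangle,\qquad(\mathcal{B})_{\alpha\beta}=\langle\Omega_y\Phi_\beta,\Phi_\alpha\rangle,$$ where $\alpha,\beta$ run over the real spherical harmonics of degree at most $N$ that are even in $\mu$, ordered by degree. Then $\mathcal{A}$ and $\mathcal{B}$ are symmetric and, when partitioned by degree, block tridiagonal with zero diagonal blocks: there are matrices $A_l,B_l\in\mathbb{R}^{(l+2)\times(l+1)}$, $0\le l\le N-1$, such that $$\mathcal{A}=\frac12\begin{pmatrix} 0 & A_0^T \\ A_0 & 0 & A_1^T \\ & \ddots & \ddots & \ddots \\ & & A_{N-2} & 0 & A_{N-1}^T \\ & & & A_{N-1} & 0 \end{pmatrix},\qquad\mathcal{B}=\frac12\begin{pmatrix} 0 & B_0^T \\ B_0 & 0 & B_1^T \\ & \ddots & \ddots & \ddots \\ & & B_{N-2} & 0 & B_{N-1}^T \\ & & & B_{N-1} & 0 \end{pmatrix},$$ where blank blocks are zero. In particular the $P_N$ system is hyperbolic, i.e. every real linear combination $\xi\mathcal{A}+\eta\mathcal{B}$, $\xi,\eta\in\mathbb{R}$, is diagonalizable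 over $\mathbb{R}$.
   Context: Parameterize $\Omega\in\mathbb{S}^2$ by $\Omega=(\Omega_x,\Omega_y,\Omega_z)=(\sqrt{1-\mu^2}\cos\varphi,\sqrt{1-\mu^2}\sin\varphi,\mu)$, $\mu\in[-1,1]$, $\varphi\in[0,2\pi)$, with surface measure $d\Omega=d\mu\,d\varphi$, and let $\langle f,g\rangle=\int_{\mathbb{S}^2}fg\,d\Omega$. With $P_l$, $P_l^m$ the Legendre and associated Legendre functions and $N_l^m=\sqrt{\frac{2l+1}{4\pi}\frac{(l-m)!}{(l+m)!}}$, the real spherical harmonics are $\Phi_l^0=N_l^0P_l(\mu)$ for $l\ge0$ and, for $1\le m\le l$, $\Phi_l^{m,\mathrm c}=\sqrt2N_l^mP_l^m(\mu)\cos(m\varphi)$, $\Phi_l^{m,\mathrm s}=\sqrt2N_l^mP_l^m(\mu)\sin(m\varphi)$; $l$ is the degree and $m$ the order. Those even in $\mu$ are the ones with $l+m$ even; for each degree $l$ there are $l+1$ of them, ordered as $(\Phi_l^0,\Phi_l^{2,\mathrm c},\Phi_l^{2,\mathrm s},\dots,\Phi_l^{l,\mathrm c},\Phi_l^{l,\mathrm s})$ for $l$ even and $(\Phi_l^{1,\mathrm c},\Phi_l^{1,\mathrm s},\Phi_l^{3,\mathrm c},\Phi_l^{3,\mathrm s},\dots,\Phi_l^{l,\mathrm c},\Phi_l^{l,\mathrm s})$ for $l$ odd. The rows and columns of $\mathcal{A},\mathcal{B}$ are indexed by these functions for $l=0,1,\dots,N$ in this order, so block $(l,l')$ has size $(l+1)\times(l'+1)$.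 The $P_N$ system is the Galerkin projection onto the span of these functions of the equation $\partial_t\psi+\Omega_x\partial_x\psi+\Omega_y\partial_y\psi=\sigma_s\bigl(\frac1{4\pi}\int_{\mathbb{S}^2}\psi\,d\Omega'-\psi\bigr)-\sigma_a\psi$ (with $\sigma_s,\sigma_a\ge0$ functions of $(x,y)$), $\boldsymbol{u}$ is the vector of coefficients, and $\mathcal{Q}$ is the resulting diagonal collision matrix, which plays no role in the claim. *)

(* Defs.v *)
From HB Require Import structures.
From mathcomp Require Import all_boot all_order all_algebra.
From mathcomp Require Import all_classical all_reals all_analysis.

Set Implicit Arguments.
Unset Strict Implicit.
Unset Printing Implicit Defensive.

Import Order.TTheory GRing.Theory Num.Theory.
Import numFieldNormedType.Exports.

Local Open Scope classical_set_scope.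
Local Open Scope ring_scope.

(* Functions on the sphere are written in the coordinates z = (mu, phi), with
   Omega = (sqrt (1 - mu^2) cos phi, sqrt (1 - mu^2) sin phi, mu). *)

Definition sphere_domain (R : realType) : set (R * R) :=
  `[-1, 1]%classic `*` `[0, 2 * pi[%classic.

Definition Omega_x (R : realType) (z : R * R) : R :=
  Num.sqrt (1 - z.1 ^+ 2) * cos z.2.

Definition Omega_y (R : realType) (z : R * R) : R :=
  Num.sqrt (1 - z.1 ^+ 2) * sin z.2.

(* In these coordinates the surface measure of the sphere is dmu dphi. *)
Definition sphere_dot (R : realType) (f g : R * R -> R) : R :=
  \int[(lebesgue_measure \x lebesgue_measure)%E]_(z in @sphere_domain R)
    (f z * g z).

(* Rodrigues' formula. *)
Definition legendre (R : realType) (l : nat) : {poly R} :=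
  (2 ^+ l * l`!%:R)^-1 *: ((('X ^+ 2 - 1) ^+ l)^`(l)).

(* Condon-Shortley sign convention; the function is only used on [-1, 1]. *)
Definition assoc_legendre (R : realType) (l m : nat) (mu : R) : R :=
  (-1) ^+ m * Num.sqrt (1 - mu ^+ 2) ^+ m * ((legendre R l)^`(m)).[mu].

Definition sph_norm (R : realType) (l m : nat) : R :=
  Num.sqrt ((2 * l + 1)%:R / (4 * pi) * ((l - m)`!%:R / (l + m)`!%:R)).

Definition Phi_0 (R : realType) (l : nat) (z : R * R) : R :=
  sph_norm R l 0 * (legendre R l).[z.1].

Definition Phi_c (R : realType) (l m : nat) (z : R * R) : R :=
  Num.sqrt 2 * sph_norm R l m * assoc_legendre l m z.1 * cos (m%:R * z.2).

Definition Phi_s (R : realType) (l m : nat) (z : R * R) : R :=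
  Num.sqrt 2 * sph_norm R l m * assoc_legendre l m z.1 * sin (m%:R * z.2).

(* The harmonics of degree l that are even in mu, i.e. with l + m even, by
   increasing order m, the cosine before the sine. *)
Definition even_harmonics_deg (R : realType) (l : nat) : seq (R * R -> R) :=
  flatten [seq if m == 0%N then [:: @Phi_0 R l]
               else [:: @Phi_c R l m; @Phi_s R l m]
          | m <- iota 0 l.+1 & ~~ odd (l + m)].

Definition even_harmonics (R : realType) (N : nat) : seq (R * R -> R) :=
  flatten [seq even_harmonics_deg R l | l <- iota 0 N.+1].

Definition pn_dim (N : nat) : nat := ((N.+1 * N.+2)./2)%N.

Lemma pn_dimE (N : nat) : (\sum_(l < N.+1) l.+1)%N = pn_dim N.
Proof.
elim: N => [|N IHN]; first by rewrite big_ord_recr big_ord0.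
rewrite big_ord_recr [LHS]/= IHN /pn_dim.
have H : (N.+2 * N.+3 = N.+1 * N.+2 + N.+2.*2)%N.
  by rewrite -muln2 [(N.+1 * _)%N]mulnC -mulnDr addn2.
by rewrite H halfD odd_double doubleK andbF.
Qed.

Lemma size_even_harmonics_deg (R : realType) (l : nat) :
  size (even_harmonics_deg R l) = l.+1.
Proof.
rewrite /even_harmonics_deg size_flatten /shape -map_comp sumnE big_map.
rewrite big_filter.
rewrite (eq_bigr (fun m => if m == 0%N then 1 else 2)%N); last first.
  by move=> m _ /=; case: ifP.
suff H k : (\sum_(m <- iota 0 k.+1 | ~~ odd (l + m)) (if m == 0 then 1 else 2)
            = k + ~~ odd (l + k))%N.
  by rewrite H addnn odd_double addn1.
elim: k => [|k IHk]; first by rewrite big_cons big_nil addn0; case: odd.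
rewrite -(addn1 k.+1) iotaD big_cat /= IHk big_cons big_nil add0n addnS /=.
by rewrite negbK; case: odd; rewrite /= ?addn0 ?addn1 ?addn2.
Qed.

(* In particular the default value of nth in even_harmonic is never used. *)
Lemma size_even_harmonics (R : realType) (N : nat) :
  size (even_harmonics R N) = pn_dim N.
Proof.
rewrite /even_harmonics size_flatten /shape -map_comp sumnE big_map -pn_dimE.
rewrite -[iota 0 N.+1]/(index_iota 0 N.+1) big_mkord.
by apply: eq_bigr => l _; rewrite /= size_even_harmonics_deg.
Qed.

Definition even_harmonic (R : realType) (N : nat) (a : 'I_(pn_dim N)) :
    R * R -> R :=
  nth (fun=> 0) (even_harmonics R N) a.

Definition pn_x (R : realType) (N : nat) : 'M[R]_(pn_dim N) :=
  \matrix_(a, b) sphere_dot (fun z => Omega_x z * even_harmonic b z)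
                            (even_harmonic a).

Definition pn_y (R : realType) (N : nat) : 'M[R]_(pn_dim N) :=
  \matrix_(a, b) sphere_dot (fun z => Omega_y z * even_harmonic b z)
                            (even_harmonic a).

(* Block (i, j) of the block tridiagonal matrix with zero diagonal blocks,
   subdiagonal blocks C_0, C_1, ... and superdiagonal blocks C_0^T, C_1^T, ...
   Here conform_mx only transports C_j (resp. C_i^T) along i = j.+1
   (resp. j = i.+1); the sizes agree in both cases. *)
Definition tridiag_block (R : realType) (C : forall l, 'M[R]_(l.+2, l.+1))
    (i j : nat) : 'M[R]_(i.+1, j.+1) :=
  if i == j.+1 then conform_mx 0 (C j)
  else if j == i.+1 then conform_mx 0 (C i)^T
  else 0.

(* Only C_0, ..., C_(N-1) occur. *)
Definition tridiag_mx (R : realType) (N : nat)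
    (C : forall l, 'M[R]_(l.+2, l.+1)) : 'M[R]_(pn_dim N) :=
  castmx (pn_dimE N, pn_dimE N)
    (\mxblock_(i < N.+1, j < N.+1) tridiag_block C i j).

(* Hyperbolicity of d_t u + A d_x u + B d_y u = Q u. *)
Definition hyperbolic (R : realType) (n : nat) (A B : 'M[R]_n) : Prop :=
  forall xi eta : R, diagonalizable (xi *: A + eta *: B).

(* Main.v *)
Require Import Defs.
From mathcomp Require Import all_boot all_order all_algebra.
From mathcomp Require Import all_classical all_reals all_analysis.
From mathcomp Require Import measurable_realfun complex ring lra zify.

Set Implicit Arguments.
Unset Strict Implicit.
Unset Printing Implicit Defensive.

(** Up to a constant and a phase shift t, every real harmonic of degree l and
    order m is (1 - mu^2)^(m/2) P_l^(m)(mu) cos (m phi + t), and Omega_x and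
    Omega_y are sqrt (1 - mu^2) cos (phi + t).  By Fubini an entry of A or B
    between (l, m) and (k, n) is an integral in mu times an integral in phi, and
    the latter vanishes unless |m - n| = 1.  If n = m + 1, parity gives l <> k,
    and the integrand in mu is, up to sign, (mu^2 - 1)^(m+1) P_l^(m) P_k^(m+1).
    By Rodrigues' formula and repeated integration by parts,
    (mu^2 - 1)^m P_l^(m) is orthogonal to all polynomials of degree < l - m;
    applied to the harmonic of larger degree, this kills the entry unless
    |l - k| = 1.  The matrices being real symmetric, hyperbolicity is the
    spectral theorem. *)

Import Order.TTheory GRing.Theory Num.Theory.
Import numFieldNormedType.Exports.
Local Open Scope classical_set_scope.
Local Open Scope ring_scope.

(** * Integration by parts and Rodrigues orthogonality on [-1, 1] *)

Section PolynomialOrthogonality.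
Variable R : realType.
Implicit Types p q r V W : {poly R}.

Lemma Rintegral_is_derive (F f : R -> R) (a b : R) : a < b -> continuous f ->
    (forall x : R, is_derive x (1 : R) F (f x)) ->
  \int[lebesgue_measure]_(x in `[a, b]) f x = F b - F a.
Proof.
move=> ab cf dF.
have cF : continuous F.
  by move=> x; apply/differentiable_continuous/derivable1_diffP; case: (dF x).
rewrite /Rintegral (@continuous_FTC2 _ f F) //.
- by apply: continuous_subspaceT => x; exact: cf.
- split=> [x _||]; first by case: (dF x).
  + exact/cvg_at_right_filter/cF.
  + exact/cvg_at_left_filter/cF.
- by move=> x _; rewrite derive1E; case: (dF x).
Qed.

Lemma continuous_integrable_itv (f : R -> R) (a b : R) : continuous f ->
  lebesgue_measure.-integrable `[a, b] (EFin \o f).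
Proof.
move=> cf; apply: continuous_compact_integrable; first exact: segment_compact.
by apply: continuous_subspaceT => x; exact: cf.
Qed.

Lemma dvdp_expn_deriv r p n : r ^+ n.+1 %| p -> r ^+ n %| p^`().
Proof.
move=> /dvdpP[q ->]; rewrite derivM dvdp_add //.
  by rewrite exprS dvdp_mull // dvdp_mulIr.
by rewrite deriv_exp /= -mulr_natl !mulrA dvdp_mulIr.
Qed.

Lemma dvdp_expn_derivn r p n j : (j <= n)%N ->
  r ^+ n %| p -> r ^+ (n - j) %| p^`(j).
Proof.
move=> le_jn rp; elim: j le_jn => [|j IHj] le_jn; first by rewrite subn0.
by rewrite derivnS; apply: dvdp_expn_deriv; rewrite -subSn // subSS IHj // ltnW.
Qed.

(** Each derivative costs at most one factor [r], so fewer than n of them leave one. This kills the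
    boundary terms below. *)
Lemma root_derivn_expn r p n j x : (j < n)%N ->
  r ^+ n %| p -> root r x -> root p^`(j) x.
Proof.
move=> lt_jn rp; rewrite -!dvdp_XsubCl => rx.
apply: dvdp_trans (dvdp_expn_derivn (ltnW lt_jn) rp).
by rewrite -(subnSK lt_jn) exprS dvdp_mulr.
Qed.

Definition poly_int p : R := \int[lebesgue_measure]_(x in `[-1, 1]) p.[x].

Lemma poly_int_deriv p : poly_int p^`() = p.[1] - p.[-1].
Proof.
rewrite /poly_int (@Rintegral_is_derive (horner p)) //.
exact: continuous_horner.
Qed.

Lemma poly_intD p q : poly_int (p + q) = poly_int p + poly_int q.
Proof.
rewrite /poly_int -RintegralD //; last 2 first.
- exact/continuous_integrable_itv/continuous_horner.
- exact/continuous_integrable_itv/continuous_horner.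
by apply: eq_Rintegral => x _; rewrite hornerD.
Qed.

Lemma poly_intZ a p : poly_int (a *: p) = a * poly_int p.
Proof.
rewrite /poly_int -RintegralZl //; last first.
  exact/continuous_integrable_itv/continuous_horner.
by apply: eq_Rintegral => x _; rewrite hornerZ.
Qed.

Lemma poly_int_by_parts W V n :
    (forall i j, (i + j < n)%N -> forall x, root ('X ^+ 2 - 1) x ->
      root (W^`(i) * V^`(j)) x) ->
  poly_int (W * V^`(n)) = (-1) ^+ n * poly_int (W^`(n) * V).
Proof.
elim: n W => [|n IHn] W vanish; first by rewrite mul1r.
have bdry x : root ('X ^+ 2 - 1) x -> (W * V^`(n)).[x] = 0.
  by move=> x1; apply/rootP/(vanish 0 n).
have -> : W * V^`(n.+1) = (W * V^`(n))^`() + (-1) *: (W^`() * V^`(n)).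
  by rewrite derivM derivnS scaleN1r addrC addKr.
rewrite poly_intD poly_intZ poly_int_deriv !bdry; last 2 first.
- by rewrite /root !hornerE; apply/eqP; ring.
- by rewrite /root !hornerE; apply/eqP; ring.
rewrite subrr add0r IHn => [|i j ij x x1]; last first.
  by rewrite -derivSn vanish.
by rewrite -derivSn mulrA exprS.
Qed.

Lemma size_derivn p n : (size p^`(n) <= size p - n)%N.
Proof.
apply/leq_sizeP => i le_i; rewrite coef_derivn nth_default ?mul0rn //.
by rewrite -leq_subLR.
Qed.

Lemma size_sqrX_sub1 n : (size (('X ^+ 2 - 1 : {poly R}) ^+ n) <= (2 * n).+1)%N.
Proof.
have := size_exp ('X ^+ 2 - 1%:P : {poly R}) n.
rewrite size_XnsubC // polyC1 /=.
by move: (size (_ : {poly R})) => s; lia.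
Qed.

(** All l + m derivatives are moved onto (X^2 - 1)^m q, whose degree is less than l + m. In a
    boundary term with i + j < l + m, either i < m or j < l, so one of the two factors still
    vanishes at 1 and -1. *)
Lemma poly_int_orthogonal l m q : (m <= l)%N -> (size q <= l - m)%N ->
  poly_int (('X ^+ 2 - 1) ^+ m * q * (('X ^+ 2 - 1) ^+ l)^`(l + m)) = 0.
Proof.
move=> le_ml sq; rewrite poly_int_by_parts => [|i j ij x x1].
  rewrite derivn_poly0 ?mul0r; last first.
    have [->|q0] := eqVneq q 0; first by rewrite mulr0 size_poly0.
    rewrite (leq_trans (size_polyMleq _ _)) //.
    rewrite -size_poly_gt0 in q0; move: (size_sqrX_sub1 m) sq q0.
    by move: (size (_ : {poly R})) (size q) => s t; lia.
  by rewrite -(scale0r 0) poly_intZ mul0r mulr0.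
rewrite rootM; have [lt_im|le_mi] := ltnP i m.
  by rewrite (root_derivn_expn lt_im _ x1) // dvdp_mulr.
by rewrite (@root_derivn_expn _ _ l j _ _ _ x1) ?orbT //; lia.
Qed.
End PolynomialOrthogonality.

(** * Fubini for functions with separated variables *)

Section ProductIntegral.
Context d1 d2 (T1 : measurableType d1) (T2 : measurableType d2) (R : realType).
Variables (m1 : {sigma_finite_measure set T1 -> \bar R})
  (m2 : {sigma_finite_measure set T2 -> \bar R}).

Lemma integrable_prodM (f : T1 -> R) (g : T2 -> R) :
    m1.-integrable setT (EFin \o f) -> m2.-integrable setT (EFin \o g) ->
  (m1 \x m2)%E.-integrable setT (EFin \o (fun z => f z.1 * g z.2)).
Proof.
move=> intf intg.
have mf : measurable_fun setT f.
  by apply/measurable_EFinP; case/integrableP: intf.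
have mg : measurable_fun setT g.
  by apply/measurable_EFinP; case/integrableP: intg.
apply/integrable12ltyP.
  apply/measurable_EFinP/measurable_funM.
  - exact: measurableT_comp.
  - exact: measurableT_comp.
have intg' := integrable_norm intg; have intf' := integrable_norm intf.
have Efin := integrable_fin_num measurableT intg'.
under eq_integral => x _.
  under eq_integral => y _ do rewrite /= normrM EFinM.
  (* The inner integral is exhibited as a real constant, so that it can leave the outer one. *)
  rewrite (integralZl measurableT intg') -(fineK Efin).
  over.
rewrite (integralZr measurableT intf') -ge0_fin_numE.
  by apply: fin_numM => //; exact: (integrable_fin_num measurableT intf').
apply: mule_ge0; rewrite ?fineK //; apply: integral_ge0 => *; exact: normr_ge0.
Qed.

Lemma Rintegral_prodM (f : T1 -> R) (g : T2 -> R) :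
    m1.-integrable setT (EFin \o f) -> m2.-integrable setT (EFin \o g) ->
  \int[(m1 \x m2)%E]_z (f z.1 * g z.2) =
    (\int[m1]_x f x) * (\int[m2]_y g y).
Proof.
move=> intf intg; rewrite -RintegralZr //.
have intfg := integrable_prodM intf intg.
rewrite [LHS]/Rintegral -(integral12_prod_meas1 intfg).
congr fine; apply: eq_integral => x _; rewrite /fubini_F /=.
under eq_integral do rewrite EFinM.
by rewrite integralZl // EFinM fineK // integrable_fin_num.
Qed.

(** Extension by zero reduces this to the whole spaces: the extension of a separated function from a
    rectangle is again separated. *)
Lemma Rintegral_prodX (A : set T1) (B : set T2) (f : T1 -> R) (g : T2 -> R) :
    measurable A -> measurable B ->
    m1.-integrable A (EFin \o f) -> m2.-integrable B (EFin \o g) ->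
  \int[(m1 \x m2)%E]_(z in A `*` B) (f z.1 * g z.2) =
    (\int[m1]_(x in A) f x) * (\int[m2]_(y in B) g y).
Proof.
move=> mA mB /(integrable_mkcond _ mA) intf /(integrable_mkcond _ mB) intg.
rewrite !restrict_EFin in intf intg.
rewrite [LHS]Rintegral_mkcond (Rintegral_mkcond _ A) (Rintegral_mkcond _ B).
rewrite -Rintegral_prodM //; apply: eq_Rintegral => z _.
rewrite !patchE in_setX; case: (z.1 \in A) => /=; last by rewrite mul0r.
by case: ifP => // _; rewrite mulr0.
Qed.

End ProductIntegral.

(** * Separation of mu and phi, and the trigonometric integrals *)

Section SphereIntegral.
Variable R : realType.

Lemma Rintegral_prod_itv (f g : R -> R) (a b c d : R) :
    continuous f -> continuous g ->
  \int[(lebesgue_measure \x lebesgue_measure)%E]_(z in `[a, b] `*` `[c, d[)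
      (f z.1 * g z.2) =
    (\int[lebesgue_measure]_(x in `[a, b]) f x) *
    (\int[lebesgue_measure]_(y in `[c, d]) g y).
Proof.
move=> cf cg.
have intg : lebesgue_measure.-integrable `[c, d[ (EFin \o g).
  apply: integrableS (continuous_integrable_itv c d cg) => //.
  by apply: subset_itvl; rewrite bnd_simp.
(* The endpoint d is a null set. *)
rewrite -(Rintegral_itv_bndo_bndc intg).
apply: (@Rintegral_prodX _ _ _ _ _ lebesgue_measure lebesgue_measure) => //.
exact: continuous_integrable_itv.
Qed.

(** The phase treats sines and cosines together; integer frequencies admit the differences produced
    by product-to-sum. *)
Definition cos_wave (k : int) (t x : R) : R := cos (k%:~R * x + t).

Lemma continuous_cos_wave k t : continuous (cos_wave k t).
Proof.
move=> x; apply: continuous_comp; last exact: continuous_cos.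
apply: cvgD; last exact: cvg_cst.
by apply: cvgM; [exact: cvg_cst | exact: cvg_id].
Qed.

Lemma sin_period (n : int) (x : R) : sin (n%:~R * (2 * pi) + x) = sin x.
Proof.
have per (m : nat) y : sin (m%:R * (2 * pi) + y) = sin y :> R.
  have -> : m%:R * (2 * pi) + y = y + pi *+ 2 *+ m by ring.
  exact: (periodicn (@sinD2pi R)).
case: n => m; first exact: per.
by rewrite NegzE mulrNz mulNr -[LHS](per m.+1) addrA subrr add0r.
Qed.

Lemma Rintegral_cos_wave k t : k != 0 ->
  \int[lebesgue_measure]_(x in `[0, 2 * pi]) cos_wave k t x = 0.
Proof.
move=> k0; have kR0 : k%:~R != 0 :> R by rewrite intr_eq0.
have dsin x : is_derive x (1 : R) (fun x => sin (k%:~R * x + t) / k%:~R)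
    (cos_wave k t x).
  apply: is_derive_eq.
  rewrite /cos_wave !scaler0 /GRing.scale /= add0r mulr1 addr0.
  by rewrite mulrCA mulVf ?mulr1.
rewrite (Rintegral_is_derive _ _ dsin).
- by rewrite sin_period mulr0 add0r subrr.
- by rewrite mulr_gt0 // pi_gt0.
- exact: continuous_cos_wave.
Qed.

Lemma cos_waveM j k t u x : cos_wave j t x * cos_wave k u x =
  2^-1 * (cos_wave (j + k) (t + u) x + cos_wave (j - k) (t - u) x).
Proof.
rewrite /cos_wave.
have -> : (j + k)%:~R * x + (t + u) = (j%:~R * x + t) + (k%:~R * x + u) :> R.
  by rewrite intrD; ring.
have -> : (j - k)%:~R * x + (t - u) = (j%:~R * x + t) - (k%:~R * x + u) :> R.
  by rewrite intrB; ring.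
by move: (j%:~R * x + t) (k%:~R * x + u) => y z; rewrite cosD cosB; field.
Qed.

(** Product-to-sum yields four waves of frequencies 1 + j + k, 1 + j - k, 1 - j + k and 1 - j - k.
    None is zero: the last would need {j, k} = {0, 1}, which is excluded as well. *)
Lemma Rintegral_cos_wave3 (j k : nat) (t u v : R) : j.+1 <> k -> k.+1 <> j ->
  \int[lebesgue_measure]_(x in `[0, 2 * pi])
    (cos_wave 1 t x * cos_wave j u x * cos_wave k v x) = 0.
Proof.
move=> jk kj.
under eq_Rintegral => x _ do
  rewrite cos_waveM -mulrA mulrDl !cos_waveM -mulrDr mulrA.
have intw a b :
    lebesgue_measure.-integrable `[0, 2 * pi] (EFin \o cos_wave a b).
  exact/continuous_integrable_itv/continuous_cos_wave.
have intwD a b a' b' : lebesgue_measure.-integrable `[0, 2 * pi]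
    (EFin \o (fun x => cos_wave a b x + cos_wave a' b' x)).
  exact: (@integrableD _ _ _ _ _ _ _ _ (intw a b) (intw a' b')).
have intwDD a b a' b' a2 b2 a3 b3 : lebesgue_measure.-integrable `[0, 2 * pi]
    (EFin \o (fun x => cos_wave a b x + cos_wave a' b' x +
                       (cos_wave a2 b2 x + cos_wave a3 b3 x))).
  exact: (@integrableD _ _ _ _ _ _ _ _ (intwD a b a' b') (intwD a2 b2 a3 b3)).
rewrite RintegralZl ?RintegralD //.
by rewrite !Rintegral_cos_wave ?addr0 ?mulr0 //; lia.
Qed.
End SphereIntegral.

(** * Legendre functions and the integrals in mu *)

Section Legendre.
Variable R : realType.

Lemma size_legendre l : (size (legendre R l) <= l.+1)%N.
Proof.
apply: leq_trans (size_scale_leq _ _) _; apply: leq_trans (size_derivn _ _) _.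
by rewrite leq_subLR (leq_trans (size_sqrX_sub1 R l)) //; lia.
Qed.

Lemma poly_int_legendre l m (q : {poly R}) :
    (m <= l)%N -> (size q <= l - m)%N ->
  poly_int (('X ^+ 2 - 1) ^+ m * q * (legendre R l)^`(m)) = 0.
Proof.
move=> ml sq; rewrite /legendre derivnZ -scalerAr poly_intZ.
have -> : (('X ^+ 2 - 1) ^+ l)^`(l)^`(m) =
    (('X ^+ 2 - 1) ^+ l)^`(l + m) :> {poly R}.
  by rewrite /derivn addnC iterD.
by rewrite poly_int_orthogonal // mulr0.
Qed.

(** If k > l + 1, the test polynomial against P_k^(m+1) is P_l^(m), of degree at most l - m. If l >
    k + 1, one factor X^2 - 1 joins P_k^(m+1) to form a test polynomial of degree at most k - m + 1
    against P_l^(m). *)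
Lemma poly_int_legendre2 l k m : (m < k)%N -> (m <= l)%N ->
    (l.+1 < k)%N || (k.+1 < l)%N ->
  poly_int (('X ^+ 2 - 1) ^+ m.+1 * (legendre R l)^`(m) *
    (legendre R k)^`(m.+1)) = 0.
Proof.
move=> mk ml /orP[lk|kl].
  apply: poly_int_legendre => //.
  have := size_legendre l; have := size_derivn (legendre R l) m; lia.
rewrite mulrAC exprSr -(mulrA (_ ^+ m)); apply: poly_int_legendre => //.
apply: leq_trans (size_polyMleq _ _) _.
have := size_sqrX_sub1 R 1; rewrite expr1.
have := size_legendre k; have := size_derivn (legendre R k) m.+1; lia.
Qed.

(** The associated Legendre function without its sign (-1)^m. *)
Definition zonal l m (x : R) :=
  Num.sqrt (1 - x ^+ 2) ^+ m * ((legendre R l)^`(m)).[x].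

Lemma continuous_sqrt_1BX2 : continuous (fun x : R => Num.sqrt (1 - x ^+ 2)).
Proof.
move=> x; apply: (@continuous_comp _ _ _ (fun x : R => 1 - x ^+ 2) Num.sqrt).
  by apply: cvgB; [exact: cvg_cst | exact: exprn_continuous].
exact: sqrt_continuous.
Qed.

Lemma continuous_zonal l m : continuous (zonal l m).
Proof.
move=> x; apply: cvgM; last exact: continuous_horner.
apply: (@continuous_comp _ _ _ (fun x : R => Num.sqrt (1 - x ^+ 2))
  (fun y => y ^+ m)).
  exact: continuous_sqrt_1BX2.
exact: exprn_continuous.
Qed.

(** The square root occurs 1 + m + (m + 1) times, an even number, so on [-1, 1] the integrand is a
    polynomial: (-1)^(m+1) times that of [poly_int_legendre2]. *)
Lemma Rintegral_zonal2 l k m : (m < k)%N -> (m <= l)%N ->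
    (l.+1 < k)%N || (k.+1 < l)%N ->
  \int[lebesgue_measure]_(x in `[-1, 1])
    (Num.sqrt (1 - x ^+ 2) * zonal l m x * zonal k m.+1 x) = 0.
Proof.
move=> mk ml lk.
rewrite -[RHS](mulr0 ((-1) ^+ m.+1)) -(poly_int_legendre2 mk ml lk) -poly_intZ.
apply: eq_Rintegral => x; rewrite inE /= in_itv /= => /andP[x1 x2].
have s2 : Num.sqrt (1 - x ^+ 2) ^+ 2 = 1 - x ^+ 2.
  by rewrite sqr_sqrtr //; nra.
rewrite /zonal hornerZ !hornerM horner_exp !mulrA -exprMn.
have -> : -1 * ('X ^+ 2 - 1).[x] = Num.sqrt (1 - x ^+ 2) ^+ 2.
  by rewrite s2 !hornerE; ring.
by rewrite -exprM mulnC exprM !exprS; ring.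
Qed.
End Legendre.

(** * Vanishing inner products of harmonics *)

Section SphereDot.
Variable R : realType.

(** The constant c absorbs normalization and sign; the parity condition expresses evenness in mu. *)
Definition harmonic_form (l : nat) (f : R * R -> R) :=
  exists c m t, [/\ (m <= l)%N, ~~ odd (l + m) &
    forall z, f z = c * zonal l m z.1 * cos_wave m t z.2].

Lemma sphere_dot_harmonic_form0 l k f g t :
    harmonic_form l f -> harmonic_form k g -> l <> k.+1 -> k <> l.+1 ->
  sphere_dot (fun z => Num.sqrt (1 - z.1 ^+ 2) * cos_wave 1 t z.2 * f z) g = 0.
Proof.
move=> [c [m [u [ml pm fE]]]] [d [n [v [nk pn gE]]]] lk kl.
pose F x := Num.sqrt (1 - x ^+ 2) * zonal l m x * zonal k n x : R.
pose G x := c * d * (cos_wave 1 t x * cos_wave m u x * cos_wave n v x).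
rewrite /sphere_dot.
under eq_Rintegral => z _.
  rewrite fE gE (_ : _ * _ = F z.1 * G z.2); last by rewrite /F /G; ring.
  over.
rewrite /sphere_domain Rintegral_prod_itv; last 2 first.
- move=> x; apply: cvgM; last exact: continuous_zonal.
  by apply: cvgM; [exact: continuous_sqrt_1BX2 | exact: continuous_zonal].
- move=> x; apply: cvgM; first exact: cvg_cst.
  apply: cvgM; last exact: continuous_cos_wave.
  by apply: cvgM; exact: continuous_cos_wave.
(* Since l + m and k + n are even, neighbouring orders force l <> k, so the degrees differ by at
   least 2 and the mu-integral vanishes. *)
have [nm|nm] := eqVneq n m.+1.
  by rewrite /F nm Rintegral_zonal2 ?mul0r //; lia.
have [mn|mn] := eqVneq m n.+1.
  rewrite /F mn; under eq_Rintegral => x _ do rewrite mulrAC.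
  by rewrite Rintegral_zonal2 ?mul0r //; lia.
(* The orders are not neighbours, so the phi-integral vanishes. *)
rewrite RintegralZl //; last first.
  apply: continuous_integrable_itv => x.
  apply: cvgM; last exact: continuous_cos_wave.
  by apply: cvgM; exact: continuous_cos_wave.
by rewrite Rintegral_cos_wave3 ?mulr0 //; apply/eqP; rewrite eq_sym.
Qed.

Lemma Omega_xE : @Omega_x R =
  fun z => Num.sqrt (1 - z.1 ^+ 2) * cos_wave 1 0 z.2.
Proof. by apply/funext => z; rewrite /cos_wave mul1r addr0. Qed.

Lemma Omega_yE : @Omega_y R =
  fun z => Num.sqrt (1 - z.1 ^+ 2) * cos_wave 1 (- (pi / 2)) z.2.
Proof. by apply/funext => z; rewrite /cos_wave mul1r cosBpihalf. Qed.

Lemma harmonic_form_even l j :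
  (j < l.+1)%N -> harmonic_form l (nth (fun=> 0) (even_harmonics_deg R l) j).
Proof.
rewrite -{1}(size_even_harmonics_deg R l) => /(mem_nth (fun=> 0)).
move: (nth _ _ _) => f /flattenP[s /mapP[m]].
rewrite mem_filter mem_iota => /andP[pm ml] ->.
case: eqP pm ml => [->|_] pm ml; rewrite ?mem_seq1 ?mem_seq2.
- move=> /eqP ->; exists (sph_norm R l 0), 0%N, 0; split=> // z.
  rewrite /Phi_0 /zonal /cos_wave mul0r add0r cos0 expr0; ring.
(* The sign (-1)^m comes from [assoc_legendre]; the phase - pi / 2 turns the cosine into the
   sine. *)
- case/orP => /eqP ->.
  + exists (Num.sqrt 2 * sph_norm R l m * (-1) ^+ m), m, 0; split=> // z.
    rewrite /Phi_c /assoc_legendre /zonal /cos_wave addr0; ring.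
  + exists (Num.sqrt 2 * sph_norm R l m * (-1) ^+ m), m, (- (pi / 2)).
    split=> // z.
    rewrite /Phi_s /assoc_legendre /zonal /cos_wave cosBpihalf; ring.
Qed.
End SphereDot.

(** * The spectral theorem for real symmetric matrices *)

Section RealSpectral.
Variable R : rcfType.

(** Over the complex extension A is Hermitian, hence unitarily diagonalizable with real eigenvalues.
    The minimal polynomial brings this back to [R]: it is compatible with field extension, and
    diagonalizability means that it divides a product of distinct linear factors. *)
Lemma symmetric_diagonalizable n (A : 'M[R]_n) : A^T = A -> diagonalizable A.
Proof.
case: n A => [|n] A symA; first by rewrite flatmx0; exact: diagonalizable0.
pose toC := real_complex R; pose B := map_mx toC A.
have hermB : B \is hermsymmx.
  apply: realsym_hermsym.
    apply/is_hermitianmxP; rewrite expr0 scale1r map_mx_id //.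
    by rewrite /B map_trmx symA.
  by apply/(@mxOverP _ _ _ Num.real) => i j; rewrite mxE complex_real.
have /orthomx_spectralP defB := hermitian_normalmx hermB.
pose d := map_mx (@complex.Re R) (spectral_diag B).
have diagE : spectral_diag B = map_mx toC d.
  apply/rowP => i; rewrite !mxE; apply/esym/RRe_real.
  exact: (mxOverP (hermitian_spectral_diag_real hermB)).
apply/diagonalizableP; exists (undup [seq d 0 i | i <- enum 'I_n.+1]).
  exact: undup_uniq.
rewrite -(dvdp_map toC) -mxminpoly_map -/B [X in mxminpoly X]defB.
rewrite -[X in _ *m X](invmxK (spectralmx B)) -conjumx;
  last by rewrite unitmx_inv spectral_unit.
rewrite mxminpoly_uconj ?unitmx_inv ?spectral_unit //.
rewrite -(mxminpoly_diag d) -mxminpoly_map diagE map_diag_mx.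
exact: dvdpp.
Qed.
End RealSpectral.

(** * Block structure of the coefficient matrices *)

Section Blocks.
Variable R : realType.

(** Multiplication by h is self-adjoint. This gives both the symmetry of the matrices and the
    transposes above the diagonal. *)
Lemma sphere_dotCM (h f g : R * R -> R) :
  sphere_dot (fun z => h z * f z) g = sphere_dot (fun z => h z * g z) f.
Proof. by apply: eq_Rintegral => z _; ring. Qed.

(** Reconciles the flattened list of harmonics with the indexing of [\mxblock]: in both, the offset
    of a degree is the total size of the lower ones. *)
Lemma even_harmonic_Rank N (s : 'I_(\sum_(l < N.+1) l.+1)) :
  even_harmonic (R := R) (cast_ord (pn_dimE N) s) =
  nth (fun=> 0) (even_harmonics_deg R (tagnat.sig1 s)) (tagnat.sig2 s).
Proof.
rewrite /even_harmonic /= /even_harmonics nth_flatten.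
have shE : shape [seq even_harmonics_deg R l | l <- iota 0 N.+1] = iota 1 N.+1.
  rewrite /shape -map_comp (iotaDl 1 0); apply: eq_map => l /=.
  exact: size_even_harmonics_deg.
have -> : nat_of_ord s =
    flatten_index (iota 1 N.+1) (tagnat.sig1 s) (tagnat.sig2 s).
  rewrite [LHS]tagnat.rect /flatten_index take_iota; congr (_ + _)%N.
  rewrite (minn_idPl (ltnW (ltn_ord _))) sumnE [iota 1 _](iotaDl 1 0) big_map.
  rewrite -[X in iota 0 X]subn0 -/(index_iota 0 _).
  rewrite (@big_nat_widen _ _ _ _ _ N.+1) ?big_mkord //.
  exact: ltnW.
have lt2 : (tagnat.sig2 s < nth 0 (iota 1 N.+1) (tagnat.sig1 s))%N.
  by rewrite nth_iota // add1n.
rewrite shE flatten_indexKl // flatten_indexKr //.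
by rewrite (nth_map 0%N) ?size_iota // nth_iota.
Qed.

Lemma tridiag_harmonics N t (O : R * R -> R)
    (M := \matrix_(a, b) sphere_dot (fun z => O z * even_harmonic b z)
                            (even_harmonic a) : 'M[R]_(pn_dim N)) :
    O = (fun z => Num.sqrt (1 - z.1 ^+ 2) * cos_wave 1 t z.2) ->
  exists A : forall l : nat, 'M[R]_(l.+2, l.+1), M = 2^-1 *: tridiag_mx N A.
Proof.
move=> OE; pose h l j := nth (fun=> 0) (even_harmonics_deg R l) j.
pose dot l i k j := sphere_dot (fun z => O z * h k j z) (h l i).
(* The factor 2 cancels the 1/2 in front of the block matrix. *)
exists (fun l => \matrix_(i, j) (2 * dot l.+1 i l j)).
apply/matrixP => a b; rewrite !mxE castmxE !mxE.
set s := cast_ord _ a; set s' := cast_ord _ b.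
have -> : a = cast_ord (pn_dimE N) s by apply: val_inj.
have -> : b = cast_ord (pn_dimE N) s' by apply: val_inj.
rewrite !even_harmonic_Rank -/(dot _ _ _ _).
move: (tagnat.sig1 s) (tagnat.sig2 s) => l i.
move: (tagnat.sig1 s') (tagnat.sig2 s') => k j.
rewrite -/(h _ _) -/(dot _ _ _ _) /tridiag_block.
(* With plain natural numbers as degrees, l = k + 1 or k = l + 1 can be substituted in the index
   types, where [conform_mx] becomes the identity. *)
move: l i k j => [l _] /= i [k _] /= j.
case: eqP => [lk|lk].
  move: i; rewrite lk => i; rewrite conform_mx_id !mxE.
  by rewrite mulKf // pnatr_eq0.
case: eqP => [kl|kl].
  move: j; rewrite kl => j; rewrite conform_mx_id !mxE /dot sphere_dotCM.
  by rewrite mulKf // pnatr_eq0.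
rewrite mxE mulr0 /dot OE.
by apply: (sphere_dot_harmonic_form0 (l := k) (k := l)) => //;
  apply: harmonic_form_even.
Qed.
End Blocks.

Theorem mainTheorem2 (R : realType) (N : nat) (hN : (1 <= N)%N) :
  [/\ (pn_x R N)^T = pn_x R N,
      (pn_y R N)^T = pn_y R N,
      exists A : forall l : nat, 'M[R]_(l.+2, l.+1),
        pn_x R N = 2^-1 *: tridiag_mx N A,
      exists B : forall l : nat, 'M[R]_(l.+2, l.+1),
        pn_y R N = 2^-1 *: tridiag_mx N B
    & hyperbolic (pn_x R N) (pn_y R N)].
Proof.
have symx : (pn_x R N)^T = pn_x R N.
  by apply/matrixP => a b; rewrite !mxE sphere_dotCM.
have symy : (pn_y R N)^T = pn_y R N.
  by apply/matrixP => a b; rewrite !mxE sphere_dotCM.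
split=> //.
- exact: tridiag_harmonics (Omega_xE R).
- exact: tridiag_harmonics (Omega_yE R).
move=> xi eta; apply: symmetric_diagonalizable.
by rewrite raddfD /= !linearZ /= symx symy.
Qed.
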